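(* Let $\{K^{(n)}_{\cdot}(\cdot,\cdot)\}_{n\in\mathbb{N}^+}$ be a family of CPTNI monotone metrics. Let $n_1,n_2\in\mathbb{N}^+$, and for $i=1,2$ let $\rho_i\in\overline{\mathcal{S}}^{++}(\mathbb{C}^{n_i})$ and $X_i,Y_i\in\mathcal{B}(\mathbb{C}^{n_i})$, where $\operatorname{Tr}\rho_1+\operatorname{Tr}\rho_2\le 1$ (so that $\rho_1\oplus\rho_2\in\overline{\mathcal{S}}^{++}(\mathbb{C}^{n_1+n_2})$). Then $$K^{(n_1+n_2)}_{\rho_1\oplus\rho_2}\left(X_1\oplus X_2,\,Y_1\oplus Y_2\right)=K^{(n_1)}_{\rho_1}(X_1,Y_1)+K^{(n_2)}_{\rho_2}(X_2,Y_2).$$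
   Context: Notation. $\mathbb{N}^+$ is the set of positive integers and $\mathcal{B}(\mathbb{C}^n)$ is the set of all linear operators on $\mathbb{C}^n$. Set $\overline{\mathcal{S}}^{++}(\mathbb{C}^n)=\{\rho\in\mathcal{B}(\mathbb{C}^n)\mid \operatorname{Tr}\rho\le 1,\ \rho>0\}$ (strictly positive operators of trace at most one) and $\overline{\mathcal{S}}(\mathbb{C}^n)=\{\rho\in\mathcal{B}(\mathbb{C}^n)\mid \operatorname{Tr}\rho\le 1,\ \rho\ge 0\}$. For $A_i\in\mathcal{B}(\mathbb{C}^{n_i})$, $A_1\oplus A_2\in\mathcal{B}(\mathbb{C}^{n_1+n_2})$ is the block diagonal operator. A CPTNI (completely positive, trace non-increasing) map $T:\mathcal{B}(\mathbb{C}^n)\to\mathcal{B}(\mathbb{C}^m)$ is a map of the form $T(X)=\sum_{i=1}^k A_iXA_i^*$ with linear maps $A_1,\dots,A_k:\mathbb{C}^n\to\mathbb{C}^m$ such that $\sum_{i=1}^k A_i^*A_i\le I$. The set of all of them is denoted $\overline{\mathcal{C}}(\mathbb{C}^n,\mathbb{C}^m)$. A family of functions $\{K^{(n)}_{\cdot}(\cdot,\cdot)\}_{n\in\mathbb{N}^+}$ from $\overline{\mathcal{S}}^{++}(\mathbb{C}^n)\times\mathcal{B}(\mathbb{C}^n)\times\mathcal{B}(\mathbb{C}^n)$ to $\mathbb{C}$ is a family of CPTNI monotone metrics if: (a) for every $n\in\mathbb{N}^+$ and $\rho\in\overline{\mathcal{S}}^{++}(\mathbb{C}^n)$, the map $(X,Y)\mapsto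 K^{(n)}_\rho(X,Y)$ is a (complex, positive definite) inner product on $\mathcal{B}(\mathbb{C}^n)$, conjugate-linear in the first argument and linear in the second; (b) for every $n,m\in\mathbb{N}^+$, $T\in\overline{\mathcal{C}}(\mathbb{C}^n,\mathbb{C}^m)$, $X\in\mathcal{B}(\mathbb{C}^n)$, $\rho\in\overline{\mathcal{S}}^{++}(\mathbb{C}^n)$, and $\sigma\in\overline{\mathcal{S}}(\mathbb{C}^m)$ such that $T(\rho)+\sigma\in\overline{\mathcal{S}}^{++}(\mathbb{C}^m)$, one has $K^{(m)}_{T(\rho)+\sigma}(T(X),T(X))\le K^{(n)}_\rho(X,X)$. No continuity in $\rho$ is assumed. *)

(* Defs.v *)
From HB Require Import structures.
From mathcomp Require Import all_boot all_order all_algebra.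
From mathcomp Require Import sesquilinear spectral complex reals.

Set Implicit Arguments.
Unset Strict Implicit.
Unset Printing Implicit Defensive.

Import Order.TTheory GRing.Theory Num.Theory.
Local Open Scope ring_scope.
Local Open Scope sesquilinear_scope.
Local Open Scope complex_scope.

Section MonotoneMetrics.
Variable R : realType.
Local Notation C := R[i].

(* Operators are matrices acting on column vectors, and the adjoint is [^t*].
   In the partial order of [R[i]], [0 <= z] and [0 < z] include "z is real", so
   hermitianity of [A] follows from the two conditions below, and all the
   inequalities between complex numbers in this file are between reals. *)
Definition psdmx n (A : 'M[C]_n) : Prop :=
  forall v : 'cV[C]_n, 0 <= (v ^t* *m A *m v) 0 0.

Definition posdefmx n (A : 'M[C]_n) : Prop :=
  forall v : 'cV[C]_n, v != 0 -> 0 < (v ^t* *m A *m v) 0 0.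

Definition loewner_le n (A B : 'M[C]_n) : Prop := psdmx (B - A).

Definition substate n (rho : 'M[C]_n) : Prop :=
  \tr rho <= 1 /\ psdmx rho.

Definition pos_substate n (rho : 'M[C]_n) : Prop :=
  \tr rho <= 1 /\ posdefmx rho.

Definition cptni n m (T : 'M[C]_n -> 'M[C]_m) : Prop :=
  exists (k : nat) (A : 'I_k -> 'M[C]_(m, n)),
    (forall X, T X = \sum_(i < k) A i *m X *m (A i) ^t*) /\
    loewner_le (\sum_(i < k) (A i) ^t* *m A i) 1%:M.

(* Conjugate-linear in the first argument, linear in the second, whereas the
   library's [{dot _ for conjC}] is linear in the first. *)
Record inner_product n (f : 'M[C]_n -> 'M[C]_n -> C) : Prop := InnerProduct {
  inner_conjlinear : forall (a : C) (X X' Y : 'M[C]_n),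
    f (a *: X + X') Y = Num.conj a * f X Y + f X' Y;
  inner_linear : forall (a : C) (X Y Y' : 'M[C]_n),
    f X (a *: Y + Y') = a * f X Y + f X Y';
  inner_hermitian : forall X Y : 'M[C]_n, f Y X = Num.conj (f X Y);
  inner_posdef : forall X : 'M[C]_n, X != 0 -> 0 < f X X
}.

(* [K n rho] is the form at the base point [rho]; its values at [n = 0] and at
   matrices [rho] outside [pos_substate] are unconstrained junk. *)
Record cptni_monotone_metrics
    (K : forall n, 'M[C]_n -> 'M[C]_n -> 'M[C]_n -> C) : Prop :=
  CptniMonotoneMetrics {
  metric_inner : forall n (rho : 'M[C]_n),
    (0 < n)%N -> pos_substate rho -> inner_product (K n rho);
  metric_monotone : forall n m (T : 'M[C]_n -> 'M[C]_m)
      (X rho : 'M[C]_n) (sigma : 'M[C]_m),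
    (0 < n)%N -> (0 < m)%N -> cptni T ->
    pos_substate rho -> substate sigma -> pos_substate (T rho + sigma) ->
    K m (T rho + sigma) (T X) (T X) <= K n rho X X
}.

Definition dsummx n1 n2 (A : 'M[C]_n1) (B : 'M[C]_n2) : 'M[C]_(n1 + n2) :=
  block_mx A 0 0 B.

End MonotoneMetrics.

(* Main.v *)
(** Let [V] be an isometry and [P = V rho V^* + sigma] with [V^* sigma V = 0].
    Monotonicity under the embedding [X |-> V X V^*] and under the compression
    [Z |-> V^* Z V] shows that the embedding preserves the norm, hence, by
    polarization, the form. Compression also gives
    [K_P (V X V^* + t Z) >= K_rho (X) = K_P (V X V^* )] for all scalars [t] as
    soon as [V^* Z V = 0], and this forces [V X V^*] and [Z] to be orthogonal. The two
    coordinate embeddings of a direct sum are of this kind. *)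
Require Import Defs.
From mathcomp Require Import all_boot all_order all_algebra.
From mathcomp Require Import sesquilinear spectral complex reals.
From mathcomp Require Import ring.

Import Order.TTheory GRing.Theory Num.Theory.
Local Open Scope ring_scope.
Local Open Scope sesquilinear_scope.
Local Open Scope complex_scope.

(** * Inner products: variational orthogonality and polarization *)

Section InnerProductTheory.
Context {R : realType}.
Local Notation C := R[i].

Section OneForm.
Context {n : nat} {f : 'M[C]_n -> 'M[C]_n -> C} (hf : inner_product f).

Lemma innerDl X X' Y : f (X + X') Y = f X Y + f X' Y.
Proof. by have := inner_conjlinear hf 1 X X' Y; rewrite scale1r rmorph1 mul1r. Qed.

Lemma innerDr X Y Y' : f X (Y + Y') = f X Y + f X Y'.
Proof. by have := inner_linear hf 1 X Y Y'; rewrite scale1r mul1r. Qed.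

Lemma inner0r X : f X 0 = 0.
Proof. by apply: (addrI (f X 0)); rewrite -innerDr !addr0. Qed.

Lemma innerZr a X Y : f X (a *: Y) = a * f X Y.
Proof. by have := inner_linear hf a X Y 0; rewrite inner0r !addr0. Qed.

Lemma innerZl a X Y : f (a *: X) Y = Num.conj a * f X Y.
Proof. by rewrite (inner_hermitian hf) innerZr rmorphM /= -(inner_hermitian hf). Qed.

Lemma inner_sqrD X Y :
  f (X + Y) (X + Y) = f X X + f Y Y + (f X Y + Num.conj (f X Y)).
Proof. rewrite innerDl !innerDr (inner_hermitian hf X Y); ring. Qed.

(** For [Z != 0] the right-hand side has minimum [f X X - |f X Z|^2 / f Z Z] over [t], so it can
    stay above [f X X] only if [f X Z] vanishes. *)
Lemma inner_orthogonal X Z :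
  (forall t : C, f X X <= f (X + t *: Z) (X + t *: Z)) -> f X Z = 0.
Proof.
move=> h; have [->|nzZ] := eqVneq Z 0; first exact: inner0r.
have Zgt0 := inner_posdef hf nzZ.
have Zn0 : f Z Z != 0 by rewrite gt_eqF.
have ZJ : Num.conj (f Z Z) = f Z Z by rewrite -(inner_hermitian hf).
(* the minimizer of the quadratic function in [h] *)
have := h (- (Num.conj (f X Z) / f Z Z)).
set t := - _; rewrite inner_sqrD innerZl !innerZr.
have tJ : Num.conj t = - (f X Z / f Z Z).
  by rewrite /t rmorphN rmorphM fmorphV /= conjCK ZJ.
have -> : f X X + Num.conj t * (t * f Z Z) + (t * f X Z + Num.conj (t * f X Z))
    = f X X - `|f X Z| ^+ 2 / f Z Z.
  by rewrite rmorphM /= tJ /t normCK; field.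
rewrite -subr_ge0 addrAC subrr add0r oppr_ge0 => le0.
have : `|f X Z| ^+ 2 / f Z Z == 0.
  by rewrite eq_le le0 divr_ge0 ?exprn_ge0 ?normr_ge0 // ltW.
by rewrite mulf_eq0 invr_eq0 (negPf Zn0) orbF sqrf_eq0 normr_eq0 => /eqP.
Qed.

End OneForm.

(** Expanding the norm of [X + Y] identifies the real parts of the two forms; applying this to
    ['i *: Y] identifies the imaginary parts. *)
Lemma inner_polarization n m (f : 'M[C]_n -> 'M[C]_n -> C)
    (g : 'M[C]_m -> 'M[C]_m -> C) (L : {linear 'M[C]_n -> 'M[C]_m}) :
  inner_product f -> inner_product g -> (forall X, g (L X) (L X) = f X X) ->
  forall X Y, g (L X) (L Y) = f X Y.
Proof.
move=> hf hg e.
have re X Y : g (L X) (L Y) + Num.conj (g (L X) (L Y))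
            = f X Y + Num.conj (f X Y).
  have := e (X + Y); rewrite linearD (inner_sqrD hg) (inner_sqrD hf) !e.
  exact: addrI.
move=> X Y.
have eqD := re X Y.
(* Here the sum with the conjugate becomes ['i] times the difference, and ['i] cancels. *)
have := re X ('i *: Y).
rewrite linearZ /= (innerZr hg) (innerZr hf) !rmorphM /= conjCi !mulNr -!mulrBr.
move=> /(mulfI (neq0Ci _)) eqB.
have two (z : C) : z *+ 2 = (z + Num.conj z) + (z - Num.conj z) by ring.
by apply: (pmulrnI (n := 2)) => //; rewrite two eqD eqB -two.
Qed.

End InnerProductTheory.

(** * Behaviour of the metrics under an isometric embedding and its compression *)

Section Isometry.
Context {R : realType}.
Local Notation C := R[i].

Lemma adjmxM m n p (A : 'M[C]_(m, n)) (B : 'M[C]_(n, p)) :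
  (A *m B) ^t* = B ^t* *m A ^t*.
Proof. by rewrite trmx_mul map_mxM. Qed.

Lemma psdmx_gram m n (A : 'M[C]_(m, n)) : psdmx (A ^t* *m A).
Proof.
move=> v; rewrite mulmxA -adjmxM -mulmxA mxE sumr_ge0 // => i _.
by rewrite !mxE mulrC -normCK exprn_ge0.
Qed.

Lemma substate0 n : substate (0 : 'M[C]_n).
Proof. by split=> [|v]; rewrite ?mxtrace0 ?ler01 // mulmx0 mul0mx mxE. Qed.

Lemma cptni_kraus1 m n (A : 'M[C]_(m, n)) :
  loewner_le (A ^t* *m A) 1%:M -> cptni (fun X => A *m X *m A ^t*).
Proof.
by move=> h; exists 1%N, (fun=> A); split=> [X|]; rewrite big_ord1.
Qed.

Context {m n : nat} {V : 'M[C]_(m, n)} (hV : V ^t* *m V = 1%:M).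

Lemma cptni_embedding : cptni (fun X => V *m X *m V ^t*).
Proof.
apply: cptni_kraus1; rewrite /loewner_le hV subrr => v.
by rewrite mulmx0 mul0mx mxE.
Qed.

(** The Kraus operator is [V ^t*], so [Q = 1 - V *m V ^t*] must be positive. It is a self-adjoint
    idempotent, hence equal to the Gram matrix [Q ^t* *m Q]. *)
Lemma cptni_compression : cptni (fun Z => V ^t* *m Z *m V).
Proof.
have := @cptni_kraus1 _ _ (V ^t*); rewrite trmxCK; apply.
rewrite /loewner_le; set Q := _ - _.
have QJ : Q ^t* = Q.
  by rewrite /Q !linearB /= map_mxB trmx1 map_mx1 adjmxM trmxCK.
have QQ : Q *m Q = Q.
  rewrite {1}/Q mulmxBl mul1mx {2}/Q mulmxBr mulmx1 -mulmxA (mulmxA (V ^t*)) hV.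
  by rewrite mul1mx subrr subr0.
by rewrite -QQ -{1}QJ; apply: psdmx_gram.
Qed.

Context {K : forall k, 'M[C]_k -> 'M[C]_k -> 'M[C]_k -> C}.
Hypothesis hK : cptni_monotone_metrics K.
Hypotheses (m_gt0 : (0 < m)%N) (n_gt0 : (0 < n)%N).
Context {rho : 'M[C]_n} {sigma P : 'M[C]_m}.
Hypotheses (hrho : pos_substate rho) (hsigma : substate sigma).
Hypothesis hP : pos_substate P.
(** An equation ties [P] to [rho], so that one base point can be decomposed along different
    isometries. *)
Hypotheses (PE : P = V *m rho *m V ^t* + sigma).
Hypotheses (sigmaV : V ^t* *m sigma *m V = 0).

Let compressK X : V ^t* *m (V *m X *m V ^t*) *m V = X.
Proof. by rewrite !mulmxA hV mul1mx -mulmxA hV mulmx1. Qed.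

(** The compression does not see [sigma], so it takes the base point [P] back to [rho]. *)
Lemma metric_compression_le Z :
  K n rho (V ^t* *m Z *m V) (V ^t* *m Z *m V) <= K m P Z Z.
Proof.
(* The summand [0] is the substate added in the monotonicity axiom. *)
have PV : V ^t* *m P *m V + 0 = rho.
  by rewrite PE mulmxDr mulmxDl compressK sigmaV !addr0.
have := metric_monotone hK Z m_gt0 n_gt0 cptni_compression hP (substate0 n).
by rewrite PV; apply.
Qed.

(** The embedding, with [sigma] added, gives one inequality; the compression, a left inverse of the
    embedding, gives the other. *)
Lemma metric_embedding_sqr X :
  K m P (V *m X *m V ^t*) (V *m X *m V ^t*) = K n rho X X.
Proof.
apply/eqP; rewrite eq_le; apply/andP; split.
  have := metric_monotone hK X n_gt0 m_gt0 cptni_embedding hrho hsigma.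
  by rewrite -PE; apply.
by have := metric_compression_le (V *m X *m V ^t*); rewrite compressK.
Qed.

Lemma metric_embedding X Y :
  K m P (V *m X *m V ^t*) (V *m Y *m V ^t*) = K n rho X Y.
Proof.
exact: (@inner_polarization _ _ _ _ _ (mulmxr (V ^t*) \o mulmx V)
  (metric_inner hK n_gt0 hrho) (metric_inner hK m_gt0 hP) metric_embedding_sqr).
Qed.

Lemma metric_embedding_orthogonal X Z :
  V ^t* *m Z *m V = 0 -> K m P (V *m X *m V ^t*) Z = 0.
Proof.
move=> ZV; apply: (inner_orthogonal (metric_inner hK m_gt0 hP)) => t.
(* The compression of this operator is [X] for every [t], which bounds its norm below independently
   of [t]. *)
have := metric_compression_le (V *m X *m V ^t* + t *: Z).
rewrite mulmxDr mulmxDl compressK -scalemxAr -scalemxAl ZV scaler0 addr0.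
by rewrite metric_embedding_sqr.
Qed.

End Isometry.

(** * Coordinate inclusions of a direct sum and positivity of block diagonal operators *)

Section DirectSum.
Context {R : realType}.
Local Notation C := R[i].
Context {n1 n2 : nat}.
Implicit Types (A : 'M[C]_n1) (B : 'M[C]_n2).

Definition inlmx : 'M[C]_(n1 + n2, n1) := col_mx 1%:M 0.
Definition inrmx : 'M[C]_(n1 + n2, n2) := col_mx 0 1%:M.

Lemma adj_inlmx : inlmx ^t* = row_mx 1%:M 0.
Proof. by rewrite tr_col_mx map_row_mx trmx1 trmx0 map_mx1 map_mx0. Qed.

Lemma adj_inrmx : inrmx ^t* = row_mx 0 1%:M.
Proof. by rewrite tr_col_mx map_row_mx trmx1 trmx0 map_mx1 map_mx0. Qed.

Lemma inlmx_isometry : inlmx ^t* *m inlmx = 1%:M.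
Proof. by rewrite adj_inlmx mul_row_col mulmx1 mul0mx addr0. Qed.

Lemma inrmx_isometry : inrmx ^t* *m inrmx = 1%:M.
Proof. by rewrite adj_inrmx mul_row_col mulmx1 mul0mx add0r. Qed.

Lemma inlmx_embed A : inlmx *m A *m inlmx ^t* = dsummx A 0.
Proof.
by rewrite adj_inlmx mul_col_mx mul_col_row mul1mx !mulmx1 mul0mx !mulmx0.
Qed.

Lemma inrmx_embed B : inrmx *m B *m inrmx ^t* = dsummx 0 B.
Proof.
by rewrite adj_inrmx mul_col_mx mul_col_row mul1mx !mulmx1 mul0mx !mulmx0.
Qed.

Lemma inlmx_compress A B : inlmx ^t* *m dsummx A B *m inlmx = A.
Proof.
rewrite adj_inlmx mul_row_block mul_row_col.
by rewrite mul1mx mulmx1 mul0mx addr0 mulmx0 addr0.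
Qed.

Lemma inrmx_compress A B : inrmx ^t* *m dsummx A B *m inrmx = B.
Proof.
rewrite adj_inrmx mul_row_block mul_row_col.
by rewrite !mul1mx mulmx1 !mulmx0 !add0r.
Qed.

Lemma dsummxD A A' B B' :
  dsummx A B + dsummx A' B' = dsummx (A + A') (B + B').
Proof. by rewrite /dsummx add_block_mx !addr0. Qed.

Lemma dsummx_form A B (v : 'cV[C]_(n1 + n2)) :
  (v ^t* *m dsummx A B *m v) 0 0
  = ((usubmx v) ^t* *m A *m usubmx v) 0 0
    + ((dsubmx v) ^t* *m B *m dsubmx v) 0 0.
Proof.
rewrite -{1 2}[v]vsubmxK tr_col_mx map_row_mx mul_row_block mul_row_col.
by rewrite !mulmx0 addr0 add0r mxE.
Qed.

Lemma psdmx_dsummx A B : psdmx A -> psdmx B -> psdmx (dsummx A B).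
Proof. by move=> hA hB v; rewrite dsummx_form addr_ge0. Qed.

Lemma posdefmx_psdmx n (A : 'M[C]_n) : posdefmx A -> psdmx A.
Proof.
move=> hA v; have [->|nzv] := eqVneq v 0; first by rewrite mulmx0 mxE.
exact/ltW/hA.
Qed.

Lemma psdmx0 n : psdmx (0 : 'M[C]_n).
Proof. exact: (substate0 n).2. Qed.

(** A nonzero vector has a nonzero component in some summand, which contributes strictly; the other
    contribution is nonnegative. *)
Lemma posdefmx_dsummx A B : posdefmx A -> posdefmx B -> posdefmx (dsummx A B).
Proof.
move=> hA hB v nzv; rewrite dsummx_form.
have [u0|nzu] := eqVneq (usubmx v) 0.
  apply: ltr_wpDl; first exact: posdefmx_psdmx.
  apply: hB; apply: contra_neq nzv => d0.
  by rewrite -[v]vsubmxK u0 d0 col_mx0.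
by apply: ltr_pwDl; [exact: hA | exact: posdefmx_psdmx].
Qed.

End DirectSum.

Theorem corollary2p3 (R : realType)
    (K : forall n : nat, 'M[R[i]]_n -> 'M[R[i]]_n -> 'M[R[i]]_n -> R[i])
    (hK : cptni_monotone_metrics K)
    (n1 n2 : nat) (hn1 : (0 < n1)%N) (hn2 : (0 < n2)%N)
    (rho1 : 'M[R[i]]_n1) (rho2 : 'M[R[i]]_n2)
    (hrho1 : pos_substate rho1) (hrho2 : pos_substate rho2)
    (htr : \tr rho1 + \tr rho2 <= 1)
    (X1 Y1 : 'M[R[i]]_n1) (X2 Y2 : 'M[R[i]]_n2) :
  K (n1 + n2)%N (dsummx rho1 rho2) (dsummx X1 X2) (dsummx Y1 Y2)
  = K n1 rho1 X1 Y1 + K n2 rho2 X2 Y2.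
Proof.
have n_gt0 : (0 < n1 + n2)%N by rewrite addn_gt0 hn1.
have [[tr1 pos1] [tr2 pos2]] := (hrho1, hrho2).
have hP : pos_substate (dsummx rho1 rho2).
  by split; [rewrite mxtrace_block | exact: posdefmx_dsummx].
(* For each inclusion, the diagonal block of the other summand plays the role of [sigma]. *)
have hsigma1 : substate (dsummx (0 : 'M_n1) rho2).
  split; first by rewrite mxtrace_block mxtrace0 add0r.
  by apply: psdmx_dsummx; [exact: psdmx0 | exact: posdefmx_psdmx].
have hsigma2 : substate (dsummx rho1 (0 : 'M_n2)).
  split; first by rewrite mxtrace_block mxtrace0 addr0.
  by apply: psdmx_dsummx; [exact: posdefmx_psdmx | exact: psdmx0].
have PE1 : dsummx rho1 rho2 = inlmx *m rho1 *m inlmx ^t* + dsummx 0 rho2.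
  by rewrite inlmx_embed dsummxD addr0 add0r.
have PE2 : dsummx rho1 rho2 = inrmx *m rho2 *m inrmx ^t* + dsummx rho1 0.
  by rewrite inrmx_embed dsummxD addr0 add0r.
have split_dsum (A : 'M[R[i]]_n1) (B : 'M[R[i]]_n2) :
    dsummx A B = inlmx *m A *m inlmx ^t* + inrmx *m B *m inrmx ^t*.
  by rewrite inlmx_embed inrmx_embed dsummxD addr0 add0r.
have hi := metric_inner hK n_gt0 hP.
(* Four terms arise; the two that stay within one summand give the right-hand side. *)
rewrite (split_dsum X1) (split_dsum Y1) (innerDl hi) !(innerDr hi).
rewrite (metric_embedding inlmx_isometry hK n_gt0 hn1 hrho1 hsigma1 hP PE1);
  last exact: inlmx_compress.
rewrite (metric_embedding inrmx_isometry hK n_gt0 hn2 hrho2 hsigma2 hP PE2);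
  last exact: inrmx_compress.
(* The mixed terms vanish, since compression by one inclusion kills operators embedded by the
   other. *)
rewrite (metric_embedding_orthogonal inlmx_isometry hK n_gt0 hn1 hrho1 hsigma1
  hP PE1); first last.
- by rewrite inrmx_embed; exact: inlmx_compress.
- exact: inlmx_compress.
rewrite (metric_embedding_orthogonal inrmx_isometry hK n_gt0 hn2 hrho2 hsigma2
  hP PE2); first last.
- by rewrite inlmx_embed; exact: inrmx_compress.
- exact: inrmx_compress.
by rewrite addr0 add0r.
Qed.
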